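(* Let $q$ be an odd prime and let $E/\mathbb{Q}$ be an elliptic curve. Then every group in $\operatorname{Ent}_{2,q}(E/\mathbb{Q})$ is isomorphic to one of $1,\ \mathbb{Z}/2\mathbb{Z},\ \mathbb{Z}/3\mathbb{Z},\ S_3$. Furthermore, suppose that $T_{2,q}(E/\mathbb{Q})$ is trivial and that $\rho_{E,q}$ is surjective. Then, up to isomorphism, $$\operatorname{Ent}_{2,q}(E/\mathbb{Q})=\begin{cases}\{1,\mathbb{Z}/2\mathbb{Z},\mathbb{Z}/3\mathbb{Z}, S_3\}, &\text{if $\rho_{E,2}$ is surjective},\\ \{1,\mathbb{Z}/3\mathbb{Z}\}, &\text{if $\operatorname{im} \rho_{E,2}\cong \mathbb{Z}/3\mathbb{Z}$},\\ \{1,\mathbb{Z}/2\mathbb{Z}\}, &\text{if $\operatorname{im} \rho_{E,2}\cong \mathbb{Z}/2\mathbb{Z}$},\\ \{1\}, &\text{if $\rho_{E,2}$ is trivial.}\end{cases}$$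
   Context: All fields lie in a fixed algebraic closure $\bar{\mathbb{Q}}$. For an integer $n\ge 2$, $\rho_{E,n}:\operatorname{Gal}(\bar{\mathbb{Q}}/\mathbb{Q})\to \operatorname{GL}_2(\mathbb{Z}/n\mathbb{Z})$ is the mod $n$ Galois representation giving the action on $E[n]$; ''surjective'' means surjective onto $\operatorname{GL}_2(\mathbb{Z}/n\mathbb{Z})$. $L(E[n])$ denotes the $n$-torsion field of $E$ over $L$. For an algebraic extension $L/\mathbb{Q}$, $T_{2,q}(E/L)=\operatorname{Gal}\big(L(E[2])\cap L(E[q])/L\big)$, and $\operatorname{Ent}_{2,q}(E/\mathbb{Q})=\{T_{2,q}(E/L) : L/\mathbb{Q} \text{ algebraic}\}$, considered up to isomorphism. *)

(* Defs.v *)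
(* algC is the fixed algebraic closure of Q, so every subfield of
   algC is an algebraic extension of Q. *)
From HB Require Import structures.
From mathcomp Require Import all_boot all_order all_algebra all_fingroup.
From mathcomp Require Import all_field.
From mathcomp Require Import boolp.

Set Implicit Arguments.
Unset Strict Implicit.
Unset Printing Implicit Defensive.

Import GRing.Theory.
Local Open Scope ring_scope.

Definition group_iso (G H : groupType) : Prop :=
  exists2 f : G -> H, {morph f : x y / (x * y)%g} & bijective f.
Arguments group_iso (G H)%_type_scope.

Section SubfieldType.
Variable K : divringClosed algC.

Record subfield_of : predArgType :=
  Subfield {subfield_val : algC; _ : subfield_val \in K}.

HB.instance Definition _ := [isSub for subfield_val].
HB.instance Definition _ := [Choice of subfield_of by <:].
HB.instance Definition _ := [SubChoice_isSubIntegralDomain of subfield_of by <:].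
HB.instance Definition _ := [SubIntegralDomain_isSubField of subfield_of by <:].

End SubfieldType.

Section Gal.
Variables (F : fieldType) (k : {pred F}).

Definition is_fgal (s : F -> F) : Prop :=
  [/\ zmod_morphism s, monoid_morphism s, bijective s & {in k, s =1 id}].

(* Gal(F / k): the field automorphisms of F that fix k pointwise. *)
Record fgal : Type := MkFgal {fgal_fun :> F -> F; fgal_funP : is_fgal fgal_fun}.

Lemma fgal_eq (s t : fgal) : s =1 t -> s = t.
Proof.
case: s t => [s sP] [t tP] /= /funext eq_st; move: sP tP; rewrite eq_st => sP tP.
by congr MkFgal; apply: Prop_irrelevance.
Qed.

HB.instance Definition _ := gen_eqMixin fgal.
HB.instance Definition _ := gen_choiceMixin fgal.

HB.instance Definition _ (s : fgal) :=
  GRing.isZmodMorphism.Build F F s (let: And4 sB _ _ _ := fgal_funP s in sB).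
HB.instance Definition _ (s : fgal) :=
  GRing.isMonoidMorphism.Build F F s (let: And4 _ sM _ _ := fgal_funP s in sM).

Lemma fgal_bij (s : fgal) : bijective s. Proof. by case: (fgal_funP s). Qed.
Lemma fgal_fix (s : fgal) : {in k, s =1 id}. Proof. by case: (fgal_funP s). Qed.

Lemma fgal_one_subproof : is_fgal id.
Proof. by split=> //; exists id. Qed.
Definition fgal_one := MkFgal fgal_one_subproof.

Lemma fgal_mul_subproof (s t : fgal) : is_fgal (s \o t).
Proof.
split; first by move=> x y /=; rewrite !rmorphB.
- by split=> [|x y] /=; rewrite ?rmorph1 ?rmorphM.
- by apply: bij_comp; apply: fgal_bij.
- by move=> x kx /=; rewrite !fgal_fix.
Qed.
Definition fgal_mul s t := MkFgal (fgal_mul_subproof s t).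

Lemma fgal_surj (s : fgal) y : exists x, s x == y.
Proof. by case: (fgal_bij s) => t _ tK; exists (t y); rewrite tK. Qed.

Definition fgal_inv_fun (s : fgal) y := xchoose (fgal_surj s y).

Lemma fgal_invKV (s : fgal) : cancel (fgal_inv_fun s) s.
Proof. by move=> y; apply/eqP/(xchooseP (fgal_surj s y)). Qed.

Lemma fgal_invK (s : fgal) : cancel s (fgal_inv_fun s).
Proof. by move=> x; apply: (bij_inj (fgal_bij s)); rewrite fgal_invKV. Qed.

Lemma fgal_inv_subproof (s : fgal) : is_fgal (fgal_inv_fun s).
Proof.
split; first exact: can2_zmod_morphism (fgal_invK s) (fgal_invKV s).
- exact: can2_monoid_morphism (fgal_invK s) (fgal_invKV s).
- by exists s; [apply: fgal_invKV | apply: fgal_invK].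
- by move=> x kx /=; rewrite -{1}(fgal_fix s kx) fgal_invK.
Qed.
Definition fgal_inv s := MkFgal (fgal_inv_subproof s).

Lemma fgal_mulA : associative fgal_mul. Proof. by move=> r s t; apply: fgal_eq. Qed.
Lemma fgal_mul1g : left_id fgal_one fgal_mul. Proof. by move=> s; apply: fgal_eq. Qed.
Lemma fgal_mulg1 : right_id fgal_one fgal_mul. Proof. by move=> s; apply: fgal_eq. Qed.
Lemma fgal_mulVg : left_inverse fgal_one fgal_inv fgal_mul.
Proof. by move=> s; apply: fgal_eq => x /=; rewrite fgal_invK. Qed.
Lemma fgal_mulgV : right_inverse fgal_one fgal_inv fgal_mul.
Proof. by move=> s; apply: fgal_eq => x /=; rewrite fgal_invKV. Qed.

HB.instance Definition _ :=
  isGroup.Build fgal fgal_mulA fgal_mul1g fgal_mulg1 fgal_mulVg fgal_mulgV.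

End Gal.

(* Gal(K / L) for subfields L, K of algC with L contained in K. *)
Definition relGal (K L : divringClosed algC) : groupType :=
  fgal [pred x : subfield_of K | val x \in L].

Section Subfields.

Definition adjoin (L : divringClosed algC) (S : algC -> Prop) : {pred algC} :=
  fun x => `[< forall M : divringClosed algC,
    {subset L <= M} -> (forall z, S z -> z \in M) -> x \in M >].

Lemma adjoin_divring L S : divring_closed (adjoin L S).
Proof.
split=> [|x y /asboolP Sx /asboolP Sy|x y /asboolP Sx /asboolP Sy].
- by apply/asboolP => M _ _; apply: rpred1.
- by apply/asboolP => M LM SM; rewrite rpredB ?Sx ?Sy.
- by apply/asboolP => M LM SM; rewrite rpred_div ?Sx ?Sy.
Qed.
HB.instance Definition _ L S :=
  GRing.isDivringClosed.Build algC (adjoin L S) (adjoin_divring L S).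

Definition capfield (K1 K2 : divringClosed algC) : {pred algC} :=
  fun x => (x \in K1) && (x \in K2).

Lemma capfield_divring K1 K2 : divring_closed (capfield K1 K2).
Proof.
split=> [|x y /andP[x1 x2] /andP[y1 y2]|x y /andP[x1 x2] /andP[y1 y2]].
- by apply/andP; rewrite !rpred1.
- by apply/andP; rewrite !rpredB.
- by apply/andP; rewrite !rpred_div.
Qed.
HB.instance Definition _ K1 K2 :=
  GRing.isDivringClosed.Build algC (capfield K1 K2) (capfield_divring K1 K2).

End Subfields.

(* y^2 + a1 x y + a3 y = x^3 + a2 x^2 + a4 x + a6 over Q; ec_disc is the usual
   discriminant -b2^2 b8 - 8 b4^3 - 27 b6^2 + 9 b2 b4 b6. *)
Definition ec_disc (a1 a2 a3 a4 a6 : rat) : rat :=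
  let b2 := a1 ^+ 2 + 4 * a2 in
  let b4 := 2 * a4 + a1 * a3 in
  let b6 := a3 ^+ 2 + 4 * a6 in
  let b8 := a1 ^+ 2 * a6 + 4 * a2 * a6 - a1 * a3 * a4 + a2 * a3 ^+ 2 - a4 ^+ 2 in
  - b2 ^+ 2 * b8 - 8 * b4 ^+ 3 - 27 * b6 ^+ 2 + 9 * b2 * b4 * b6.

Record elliptic_curve := EllipticCurve {
  ec_a1 : rat; ec_a2 : rat; ec_a3 : rat; ec_a4 : rat; ec_a6 : rat;
  _ : ec_disc ec_a1 ec_a2 ec_a3 ec_a4 ec_a6 != 0
}.

Inductive point := Inf | Aff of algC & algC.

Definition point_to_opt P := if P is Aff x y then Some (x, y) else None.
Definition opt_to_point o := if o is Some (x, y) then Aff x y else Inf.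
Lemma point_to_optK : cancel point_to_opt opt_to_point. Proof. by case. Qed.
HB.instance Definition _ := Equality.copy point (can_type point_to_optK).

Section EllipticCurve.
Variable E : elliptic_curve.

Let a1 : algC := ratr (ec_a1 E).
Let a2 : algC := ratr (ec_a2 E).
Let a3 : algC := ratr (ec_a3 E).
Let a4 : algC := ratr (ec_a4 E).
Let a6 : algC := ratr (ec_a6 E).

Definition oncurve (P : point) : bool :=
  if P is Aff x y then
    y ^+ 2 + a1 * x * y + a3 * y == x ^+ 3 + a2 * x ^+ 2 + a4 * x + a6
  else true.

(* The chord-tangent law: y = l x + nu is the line through P and Q (the tangent
   when P = Q); the sum is infinity when Q = - P. *)
Definition ec_add (P Q : point) : point :=
  match P, Q with
  | Inf, _ => Q
  | _, Inf => P
  | Aff x1 y1, Aff x2 y2 =>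
    if (x1 == x2) && (y1 + y2 + a1 * x2 + a3 == 0) then Inf else
    let l := if x1 == x2
      then (3 * x1 ^+ 2 + 2 * a2 * x1 + a4 - a1 * y1) / (2 * y1 + a1 * x1 + a3)
      else (y2 - y1) / (x2 - x1) in
    let nu := y1 - l * x1 in
    let x3 := l ^+ 2 + a1 * l - a2 - x1 - x2 in
    Aff x3 (- (l + a1) * x3 - nu - a3)
  end.

Definition ec_mul (n : nat) (P : point) : point := iter n (ec_add P) Inf.

Definition ec_torsion (n : nat) (P : point) : bool :=
  oncurve P && (ec_mul n P == Inf).

Definition torsion_coord (n : nat) (z : algC) : Prop :=
  exists x y, ec_torsion n (Aff x y) /\ (z = x \/ z = y).

Definition torsion_field (L : divringClosed algC) (n : nat) : divringClosed algC :=
  adjoin L (torsion_coord n).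

(* T_{m,n}(E/L) = Gal(L(E[m]) cap L(E[n]) / L) *)
Definition entanglement (m n : nat) (L : divringClosed algC) : groupType :=
  relGal (capfield (torsion_field L m) (torsion_field L n)) L.

(* Ent_{m,n}(E/Q), as an isomorphism-closed class of groups. *)
Definition Ent (m n : nat) (G : groupType) : Prop :=
  exists L : divringClosed algC, group_iso G (entanglement m n L).

(* fgal Crat is Gal(Qbar / Q). *)
Definition ec_act (s : fgal Crat) (P : point) : point :=
  if P is Aff x y then Aff (s x) (s y) else Inf.

Lemma oncurve_act s P : oncurve (ec_act s P) = oncurve P.
Proof.
case: P => [|x y] //=; rewrite /a1 /a2 /a3 /a4 /a6 -[in RHS](fmorph_eq s).
by rewrite !(fmorph_rat s, rmorphXn s, rmorphD s, rmorphM s).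
Qed.

Lemma ec_act_add s P Q : ec_act s (ec_add P Q) = ec_add (ec_act s P) (ec_act s Q).
Proof.
have sE := (fmorph_rat s, rmorphXn s, fmorphV s, rmorph_nat s, rmorphD s,
            rmorphN s, rmorphM s).
rewrite /ec_add /a1 /a2 /a3 /a4 /a6.
case: P Q => [|x1 y1] [|x2 y2] //=; rewrite fmorph_eq.
have -> : (s y1 + s y2 + ratr (ec_a1 E) * s x2 + ratr (ec_a3 E) == 0)
  = (y1 + y2 + ratr (ec_a1 E) * x2 + ratr (ec_a3 E) == 0).
  by rewrite -[in RHS](fmorph_eq0 s) !sE.
by case: ifP => // _; case: ifP => _ /=; rewrite !sE.
Qed.

Lemma ec_act_torsion s n P : ec_torsion n P -> ec_torsion n (ec_act s P).
Proof.
case/andP=> cP /eqP nP; rewrite /ec_torsion oncurve_act cP /=; apply/eqP.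
have mulE m : ec_mul m (ec_act s P) = ec_act s (ec_mul m P).
  by elim: m => //= m IHm; rewrite ec_act_add -IHm.
by rewrite mulE nP.
Qed.

Lemma ec_act1 P : ec_act 1%g P = P. Proof. by case: P. Qed.
Lemma ec_actM s t P : ec_act (s * t)%g P = ec_act s (ec_act t P).
Proof. by case: P. Qed.

(* A choice of basis of E[n], i.e. a group isomorphism (Z/n)^2 -> E[n]. *)
Record torsion_basis (n : nat) := TorsionBasis {
  tb_fun :> 'cV['Z_n]_2 -> point;
  tb_add : forall u v, tb_fun (u + v) = ec_add (tb_fun u) (tb_fun v);
  tb_inj : injective tb_fun;
  tb_img : forall P, ec_torsion n P <-> exists v, tb_fun v = P
}.

Section Rho.
Variables (n : nat) (B : torsion_basis n).

Definition tb_coord (P : point) : 'cV['Z_n]_2 := odflt 0 [pick v | B v == P].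

Lemma tb_coordK P : ec_torsion n P -> B (tb_coord P) = P.
Proof.
move=> /(tb_img B)[v vP]; rewrite /tb_coord; case: pickP => [w /eqP //|/(_ v)].
by rewrite vP eqxx.
Qed.

Definition rho_mx (s : fgal Crat) : 'M['Z_n]_2 :=
  \matrix_(i, j) tb_coord (ec_act s (B (delta_mx j 0))) i 0.

Lemma rho_mxP s v : B (rho_mx s *m v) = ec_act s (B v).
Proof.
have torB u : ec_torsion n (B u) by apply/(tb_img B); exists u.
pose f u := tb_coord (ec_act s (B u)).
have fP u : B (f u) = ec_act s (B u) by rewrite tb_coordK // ec_act_torsion.
have fD : {morph f : u w / u + w}.
  by move=> u w; apply: (@tb_inj _ B); rewrite tb_add !fP tb_add ec_act_add.
have f0 : f 0 = 0 by apply: (addIr (f 0)); rewrite -fD !add0r.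
have fMn m u : f (u *+ m) = f u *+ m.
  by elim: m => [|m IHm]; rewrite ?mulr0n // !mulrS fD IHm.
have fZ c u : f (c *: u) = c *: f u by rewrite -[c]natr_Zp !scaler_nat fMn.
rewrite -fP; congr (B _).
have [-> ] : v = \sum_j v j 0 *: delta_mx j 0 /\ True.
  split=> //; rewrite {1}[v]matrix_sum_delta; apply: eq_bigr => j _.
  by rewrite big_ord1.
move=> _; rewrite (big_morph f fD f0) mulmx_sumr; apply: eq_bigr => j _.
rewrite fZ -scalemxAr -colE; congr (_ *: _).
by apply/matrixP => i k; rewrite !mxE ord1.
Qed.

Lemma mulcV_inj (A C : 'M['Z_n]_2) : (forall v : 'cV_2, A *m v = C *m v) -> A = C.
Proof.
move=> eqAC; apply/matrixP => i j.
by have := eqAC (delta_mx j 0); rewrite -!colE => /matrixP/(_ i 0); rewrite !mxE.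
Qed.

Lemma rho_mx1 : rho_mx 1%g = 1%:M.
Proof.
by apply: mulcV_inj => v; apply: (@tb_inj _ B); rewrite rho_mxP ec_act1 mul1mx.
Qed.

Lemma rho_mxM s t : rho_mx (s * t)%g = rho_mx s *m rho_mx t.
Proof.
apply: mulcV_inj => v; apply: (@tb_inj _ B).
by rewrite rho_mxP -mulmxA !rho_mxP ec_actM.
Qed.

Lemma rho_mx_unit s : rho_mx s \is a GRing.unit.
Proof.
have rV : rho_mx s *m rho_mx s^-1%g = 1%:M by rewrite -rho_mxM mulgV rho_mx1.
by have [] := mulmx1_unit rV.
Qed.

Definition rho (s : fgal Crat) : {'GL_2['Z_n]} := FinRing.Unit (rho_mx_unit s).

Lemma rhoM : {morph rho : s t / (s * t)%g}.
Proof. by move=> s t; apply: val_inj; apply: rho_mxM. Qed.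

Definition rho_img : {set {'GL_2['Z_n]}} := [set g | `[< exists s, rho s = g >]].

Lemma rho_img_group_set : group_set rho_img.
Proof.
apply/group_setP; split=> [|_ _ /[!inE] /asboolP[s <-] /asboolP[t <-]].
  by rewrite inE; apply/asboolP; exists 1%g; apply: val_inj; apply: rho_mx1.
by apply/asboolP; exists (s * t)%g; rewrite rhoM.
Qed.
Canonical rho_img_group := Group rho_img_group_set.

End Rho.

End EllipticCurve.

(* Main.v *)
(* Every automorphism of a subfield of algC extends to algC, so T_{2,q}(E/L) is a
   quotient of the group of permutations of the x-coordinates of the 2-torsion
   points induced by Gal(algC/L), a subgroup of S_3.  Conversely, if T_{2,q}(E/Q)
   is trivial and rho_q is surjective, Goursat's lemma makes the image of
   (rho_2, rho_q) the full product im rho_2 x GL_2(Z/q).  As GL_2(Z/2) lifts to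
   GL_2(Z), it embeds in GL_2(Z/q); over the fixed field of the preimage of the
   graph of this embedding above A <= im rho_2, the 2-torsion and the q-torsion
   field coincide and have group A. *)
Require Import Defs.
From HB Require Import structures.
From mathcomp Require Import all_boot all_order all_algebra all_fingroup.
From mathcomp Require Import all_field.
From mathcomp Require Import cyclic pgroup ring.
From mathcomp Require Import boolp.

Set Implicit Arguments.
Unset Strict Implicit.
Unset Printing Implicit Defensive.

Import GRing.Theory.
Local Open Scope ring_scope.

(** * Embeddings of subfields of the algebraic closure *)

Section Extension.

(** Elements of [algC] are algebraic over Q, so a polynomial of least size exists; the remainder of
    [f] modulo it still vanishes at [x], hence is zero. *)
Lemma subfield_minpoly (K : divringClosed algC) (x : algC) :
  exists p : {poly subfield_of K}, [/\ p != 0, root (map_poly val p) x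
    & forall f : {poly subfield_of K}, root (map_poly val f) x -> p %| f].
Proof.
pose P n := `[< exists p : {poly subfield_of K},
  [/\ p != 0, root (map_poly val p) x & size p = n] >].
have exP : exists n, P n.
  have [m [_ mon_m] rm] := minCpolyP x.
  have Kr (r : rat) : (ratr r : algC) \in K by apply/rpred_Crat/Crat_rat.
  pose m' : {poly subfield_of K} := map_poly (fun r => Subfield (Kr r)) m.
  have Dm' : map_poly val m' = map_poly ratr m :> {poly algC}.
    by rewrite /m' -map_poly_comp_id0 ?rmorph0.
  have nz_m' : m' != 0.
    rewrite -(map_poly_eq0 val) Dm' map_poly_eq0; exact: monic_neq0.
  exists (size m'); apply/asboolP; exists m'; split=> //.
  by rewrite Dm' rm dvdpp.
case: (ex_minnP exP) => _ /asboolP[p [nz_p px <-]] min_p.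
exists p; split=> // f fx; apply/eqP; rewrite -/(dvdp p f).
apply: contraTeq (ltn_modpN0 f nz_p) => nz_r; rewrite -leqNgt.
apply: min_p; apply/asboolP; exists (f %% p); split=> //.
move: fx; rewrite {1}(divp_eq f p) rmorphD rmorphM /= /root !hornerE.
by rewrite (rootP px) mulr0 add0r.
Qed.

Definition extends (K K' : divringClosed algC)
    (t : subfield_of K -> algC) (t' : subfield_of K' -> algC) :=
  {subset K <= K'} /\ forall u u', val u = val u' -> t u = t' u'.

(** * Extending an embedding to a simple extension *)

Section Simple.
Variables (K : divringClosed algC) (t : {rmorphism subfield_of K -> algC}).
Variables (x y : algC) (p : {poly subfield_of K}).
Hypotheses (nz_p : p != 0) (px : root (map_poly val p) x).
Hypothesis min_p : forall f : {poly subfield_of K}, root (map_poly val f) x -> p %| f.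
Hypothesis py : root (map_poly t p) y.

Definition simple_ext : {pred algC} :=
  fun z => `[< exists f : {poly subfield_of K}, z = (map_poly val f).[x] >].

(** Division rests on the minimality of [p]: if [g] does not vanish at [x], it is coprime to [p],
    and a Bezout relation evaluated at [x] inverts its value. *)
Lemma simple_ext_divring : divring_closed simple_ext.
Proof.
split=> [|_ _ /asboolP[f ->] /asboolP[g ->]|_ _ /asboolP[f ->] /asboolP[g ->]].
- by apply/asboolP; exists 1; rewrite rmorph1 hornerE.
- by apply/asboolP; exists (f - g); rewrite rmorphB !hornerE.
suff [h Dh]: exists h : {poly subfield_of K},
  (map_poly val g).[x]^-1 = (map_poly val h).[x].
  by apply/asboolP; exists (f * h); rewrite Dh rmorphM !hornerE.
have [gx0|nz_gx] := eqVneq (map_poly val g).[x] 0.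
  by exists 0; rewrite gx0 invr0 rmorph0 hornerE.
have co_gp : coprimep g p.
  have /dvdpP[k Dk] := dvdp_gcdl g p; have /dvdpP[h Dh] := dvdp_gcdr g p.
  have: root (map_poly val (h * gcdp g p)) x by rewrite -Dh.
  rewrite rmorphM rootM => /orP[hx|dx]; last first.
    by case/eqP: nz_gx; rewrite Dk rmorphM hornerE (rootP dx) mulr0.
  have nz_h : h != 0 by apply: contraNneq nz_p => h0; rewrite Dh h0 mul0r.
  have nz_d : gcdp g p != 0 by apply: contraNneq nz_p => d0; rewrite Dh d0 mulr0.
  have := dvdp_leq nz_h (min_p hx); rewrite {1}Dh size_mul // /coprimep.
  have := nz_d; rewrite -size_poly_gt0; case: (size (gcdp g p)) => // [[|n]] //.
  by move=> _; rewrite !addnS /= ltnNge leq_addr.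
have /Bezout_eq1_coprimepP[[u v] /= uv1] := co_gp.
exists u; apply: (mulIf nz_gx); rewrite mulVf //.
have := congr1 (fun f => (map_poly val f).[x]) uv1.
by rewrite rmorphD !rmorphM rmorph1 /= !hornerE (rootP px) mulr0 addr0.
Qed.
HB.instance Definition _ :=
  GRing.isDivringClosed.Build algC simple_ext simple_ext_divring.

Lemma simple_ext_repr (u : subfield_of simple_ext) :
  {f : {poly subfield_of K} | val u = (map_poly val f).[x]}.
Proof. by apply: cid; apply/asboolP; apply: valP u. Qed.

Definition simple_ext_fun u := (map_poly t (sval (simple_ext_repr u))).[y].

(** Two polynomials representing [u] differ by a multiple of [p], whose image under [t] vanishes at
    [y]. *)
Lemma simple_ext_funE u f :
  val u = (map_poly val f).[x] -> simple_ext_fun u = (map_poly t f).[y].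
Proof.
rewrite /simple_ext_fun; case: simple_ext_repr => g /= -> gf.
have /min_p/dvdpP[h /eqP] : root (map_poly val (g - f)) x.
  by rewrite rmorphB /root !hornerE gf subrr.
rewrite subr_eq => /eqP ->.
by rewrite rmorphD rmorphM !hornerE (rootP py) mulr0 add0r.
Qed.

Lemma simple_ext_zmod : zmod_morphism simple_ext_fun.
Proof.
move=> u v; have [[f Df] [g Dg]] := (simple_ext_repr u, simple_ext_repr v).
rewrite (simple_ext_funE Df) (simple_ext_funE Dg).
rewrite (@simple_ext_funE _ (f - g)) ?rmorphB ?hornerE //=.
by rewrite Df Dg.
Qed.

Lemma simple_ext_monoid : monoid_morphism simple_ext_fun.
Proof.
split=> [|u v]; first by rewrite (@simple_ext_funE _ 1) ?rmorph1 ?hornerE.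
have [[f Df] [g Dg]] := (simple_ext_repr u, simple_ext_repr v).
rewrite (simple_ext_funE Df) (simple_ext_funE Dg).
rewrite (@simple_ext_funE _ (f * g)) ?rmorphM ?hornerE //=.
by rewrite Df Dg.
Qed.

HB.instance Definition _ := GRing.isZmodMorphism.Build _ _ _ simple_ext_zmod.
HB.instance Definition _ := GRing.isMonoidMorphism.Build _ _ _ simple_ext_monoid.

Lemma extend_root : exists (K' : divringClosed algC)
    (t' : {rmorphism subfield_of K' -> algC}),
  extends t t' /\ exists u : subfield_of K', val u = x /\ t' u = y.
Proof.
have xK : x \in simple_ext.
  by apply/asboolP; exists 'X; rewrite map_polyX hornerX.
exists (simple_ext : divringClosed algC).
exists (simple_ext_fun : {rmorphism _ -> _}); split; last first.
  exists (Subfield xK); split=> //.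
  by apply: etrans (@simple_ext_funE _ 'X _) _; rewrite map_polyX hornerX.
split=> [z Kz|u u' Du]; last first.
  by apply: esym; apply: etrans (@simple_ext_funE _ u%:P _) _;
    rewrite map_polyC hornerC.
by apply/asboolP; exists (Subfield Kz)%:P; rewrite map_polyC hornerC.
Qed.

End Simple.

Record embedding := Embedding {
  emb_dom : divringClosed algC;
  emb_fun :> {rmorphism subfield_of emb_dom -> algC} }.

Lemma extend_step (e : embedding) (x : algC) :
  exists e' : embedding, extends e e' /\ x \in emb_dom e'.
Proof.
case: e => K t /=; have [p [nz_p px min_p]] := subfield_minpoly K x.
(* [t] is injective, so [p] keeps its size, and a nonzero constant would not vanish at [x]. *)
have /closed_rootP[y py] : size (map_poly t p) != 1%N.
  apply/negP; rewrite size_map_poly => /size_poly1P[c nz_c Dp].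
  by move: px; rewrite Dp map_polyC rootC fmorph_eq0 (negPf nz_c).
have [K' [t' [tt' [u [<- _]]]]] := extend_root nz_p px min_p py.
by exists (Embedding t'); split=> //=; apply: valP.
Qed.

(* The closure is countable, so adjoining its elements one at a time
   exhausts it. *)
Lemma extend_embedding (K : divringClosed algC)
    (t : {rmorphism subfield_of K -> algC}) :
  exists s : fgal Crat, forall u, s (val u) = t u.
Proof.
have [next nextP] := choice (fun ex => extend_step ex.1 ex.2).
(* Stage [m.+1] adjoins the element with code [m]; a number that codes nothing adjoins 0, which
   changes nothing. *)
pose e := fix e n := if n is m.+1
  then next (e m, odflt 0 (unpickle m)) else Embedding t.
have e_ext m n : (m <= n)%N -> extends (e m) (e n).
  elim: n => [|n IHn]; first by rewrite leqn0 => /eqP->; split=> // u v /val_inj->.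
  rewrite leq_eqVlt ltnS => /orP[/eqP->|/IHn[mn1 mn2]].
    by split=> // u v /val_inj->.
  have [[nn1 nn2] _] := nextP (e n, odflt 0 (unpickle n)).
  split=> [z /mn1/nn1|u v Duv] //.
  have un : val u \in emb_dom (e n) by apply/mn1/valP.
  by rewrite (mn2 u (Subfield un)) //; apply: nn2.
have xe x : x \in emb_dom (e (pickle x).+1).
  by have [_ /=] := nextP (e (pickle x), odflt 0 (unpickle (pickle x)));
    rewrite {1}pickleK.
(* Each [x] is evaluated at the stage following its code; by [sE] every stage containing [x] gives
   the same value. *)
pose s x := e _ (Subfield (xe x)).
have sE n (u : subfield_of (emb_dom (e n))) : s (val u) = e n u.
  set m := (pickle (val u)).+1; have [mn|/ltnW nm] := leqP m n.
    exact: (e_ext _ _ mn).2.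
  by apply/esym/(e_ext _ _ nm).2.
have pair x z : exists n, x \in emb_dom (e n) /\ z \in emb_dom (e n).
  exists (maxn (pickle x).+1 (pickle z).+1); split.
    by have [+ _] := e_ext _ _ (leq_maxl (pickle x).+1 (pickle z).+1); apply.
  by have [+ _] := e_ext _ _ (leq_maxr (pickle x).+1 (pickle z).+1); apply.
have s_zmod : zmod_morphism s.
  move=> x z; have [n [xn zn]] := pair x z.
  by rewrite -[x]/(val (Subfield xn)) -[z]/(val (Subfield zn)) -rmorphB !sE rmorphB.
have s_monoid : monoid_morphism s.
  split=> [|x z].
    by rewrite -[1]/(val (1 : subfield_of (emb_dom (e 0)))) sE rmorph1.
  have [n [xn zn]] := pair x z.
  by rewrite -[x]/(val (Subfield xn)) -[z]/(val (Subfield zn)) -rmorphM !sE rmorphM.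
pose sA := GRing.isZmodMorphism.Build _ _ s s_zmod.
pose sM := GRing.isMonoidMorphism.Build _ _ s s_monoid.
pose sR : {rmorphism algC -> algC} := HB.pack s sA sM.
have gal_s : is_fgal Crat s.
  split=> //.
    by exists (algC_invaut sR); [apply: (algC_autK sR)|apply: (algC_invautK sR)].
  by move=> x /(aut_Crat sR).
by exists (MkFgal gal_s) => u; apply: (sE 0%N).
Qed.

Definition fixes (S : {pred algC}) (s : fgal Crat) := {in S, s =1 id}.

(** In characteristic 0 the root [x] of its minimal polynomial is simple. If the degree exceeds 1,
    some automorphism over [L] carries [x] to another root; so the degree is 1. *)
Lemma fixes_mem (L : divringClosed algC) (x : algC) :
  (forall s, fixes L s -> s x = x) -> x \in L.
Proof.
move=> fix_x; have [p [nz_p px min_p]] := subfield_minpoly L x.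
have [p' Dp] := factor_theorem (map_poly val p) x px.
have sz_p : (1 < size p)%N.
  by rewrite -(size_map_poly val); apply: root_size_gt1 px; rewrite map_poly_eq0.
have p'x : p'.[x] != 0.
  (* At a double root the derivative vanishes too, so [p] divides it and by size it is zero, which
     characteristic 0 forbids. *)
  apply/eqP => p'x0.
  have dpx : root (map_poly val p^`()) x.
    by rewrite -deriv_map Dp derivM derivXsubC /root !hornerE p'x0 subrr mulr0 addr0.
  have dp0 : p^`() = 0.
    apply: contraTeq (lt_size_deriv nz_p) => /dvdp_leq/(_ (min_p _ dpx)).
    by rewrite -leqNgt.
  case Dn: (size p) sz_p => [|[|n]] // _.
  have /eqP : val (p^`())`_n = 0 by rewrite dp0 coef0 rmorph0.
  rewrite coef_deriv rmorphMn Num.Theory.mulrn_eq0 fmorph_eq0 /=.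
  by rewrite -[n.+1]/n.+2.-1 -Dn -lead_coefE lead_coef_eq0 (negPf nz_p).
have [/closed_rootP[y p'y]|/negPn/eqP sz1] := boolP (size p' != 1%N).
  have py : root (map_poly val p) y by rewrite Dp rootM p'y.
  have [K' [t' [[tK t'E] [u [ux uy]]]]] := extend_root (t := val) nz_p px min_p py.
  have [s sE] := extend_embedding t'.
  have sL : fixes L s.
    move=> z Lz; rewrite -[z]/(val (Subfield (tK _ Lz))) sE.
    by rewrite -(t'E (Subfield Lz)).
  by case/eqP: p'x; rewrite -(fix_x s sL) -[in s x]ux sE uy (rootP p'y).
have sz2 : size p = 2%N.
  rewrite -(size_map_poly val) Dp size_mul ?polyXsubC_eq0 ?size_XsubC ?sz1 //.
  by rewrite -size_poly_gt0 sz1.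
have p1 : val p`_1 != 0.
  by rewrite fmorph_eq0 -[1%N]/(2.-1) -sz2 -lead_coefE lead_coef_eq0.
move: px; rewrite /root horner_coef size_map_poly sz2 !big_ord_recr big_ord0 /=.
have /= pE i := coef_map val p i.
rewrite !pE expr0 expr1 mulr1 add0r addrC addr_eq0 => /eqP px0.
have -> : x = - val p`_0 / val p`_1 by rewrite -px0 mulrC mulKf.
by rewrite rpred_div ?rpredN ?(valP p`_0) ?(valP p`_1).
Qed.

End Extension.

(** * Galois theory of the algebraic closure *)

Section GaloisTheory.

Implicit Types (K L : divringClosed algC) (s : fgal Crat).

Definition fixfield (P : fgal Crat -> Prop) : {pred algC} :=
  fun x => `[< forall s, P s -> s x = x >].

Lemma fixfield_divring P : divring_closed (fixfield P).
Proof.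
split=> [|x y /asboolP Px /asboolP Py|x y /asboolP Px /asboolP Py];
  apply/asboolP => s Ps; first exact: rmorph1.
- by rewrite rmorphB /= Px ?Py.
- by rewrite rmorphM fmorphV /= Px ?Py.
Qed.
HB.instance Definition _ P :=
  GRing.isDivringClosed.Build algC (fixfield P) (fixfield_divring P).

Lemma fixesM (S : {pred algC}) s t : fixes S s -> fixes S t -> fixes S (s * t)%g.
Proof. by move=> fs ft x Sx /=; rewrite -[RHS](fs x Sx) -[in RHS](ft x Sx). Qed.

Lemma fgalVK s : cancel s (s^-1)%g.
Proof. exact: fgal_invK. Qed.

Lemma fixesV (S : {pred algC}) s : fixes S s -> fixes S (s^-1)%g.
Proof. by move=> fs x Sx; rewrite -{1}(fs x Sx) fgalVK. Qed.

(** From right to left: the fixed field of [s] alone, [fixfield (eq s)], contains [L] and [S], hence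
    the field they generate. *)
Lemma fixes_adjoin L (S : algC -> Prop) s :
  fixes (adjoin L S) s <-> fixes L s /\ (forall z, S z -> s z = z).
Proof.
split=> [fs|[fL fS] x /asboolP/(_ (fixfield (eq s)))].
  split=> [x Lx|z Sz]; apply: fs; apply/asboolP => M LM SM; [exact: LM | exact: SM].
have fixE z : s z = z -> z \in fixfield (eq s) by move=> sz; apply/asboolP => _ <-.
move=> sx; have /asboolP := sx (fun z Lz => fixE z (fL z Lz))
  (fun z Sz => fixE z (fS z Sz)).
exact.
Qed.

Definition stable_over L (S : {pred algC}) :=
  forall s, fixes L s -> {homo s : x / x \in S}.

Definition fgal_preim s K : {pred algC} := fun x => s x \in K.

Lemma fgal_preim_divring s K : divring_closed (fgal_preim s K).
Proof.
have preimE x : (x \in fgal_preim s K) = (s x \in K) by [].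
split=> [|x y|x y]; rewrite !preimE ?rmorph1 ?rpred1 // => sx sy.
  by rewrite rmorphB rpredB.
by rewrite fmorph_div rpred_div.
Qed.
HB.instance Definition _ s K :=
  GRing.isDivringClosed.Build algC (fgal_preim s K) (fgal_preim_divring s K).

(** The preimage under [s] of a field containing [L] and [S] is again such a field. *)
Lemma adjoin_stable L (S : algC -> Prop) :
  (forall s z, S z -> S (s z)) -> stable_over L (adjoin L S).
Proof.
move=> stS s fL x /asboolP Mx; apply/asboolP => M LM SM.
apply: (Mx (fgal_preim s M)) => [z Lz|z Sz]; last exact/SM/stS.
by rewrite -[_ \in _]/(s z \in M) fL ?LM.
Qed.

Lemma relGal_lift K L : {subset L <= K} -> forall r : relGal K L,
  exists s, fixes L s /\ forall u, s (val u) = val (r u).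
Proof.
move=> LK r; pose t := (val \o r : {rmorphism subfield_of K -> algC}).
have [s sE] := extend_embedding t; exists s; split=> // x Lx.
rewrite -[x]/(val (Subfield (LK _ Lx))) sE /= fgal_fix //.
Qed.

Lemma relGal_restrict K L s : stable_over L K -> fixes L s ->
  exists r : relGal K L, forall u, val (r u) = s (val u).
Proof.
move=> stK fs; have sK := stK _ fs; have sVK := stK _ (fixesV fs).
pose f t (tK : {homo t : x / x \in K}) (u : subfield_of K) : subfield_of K :=
  Subfield (tK _ (valP u)).
have gal_f : is_fgal [pred x : subfield_of K | val x \in L] (f _ sK).
  split=> [u v||| u Lu].
  - by apply: val_inj; rewrite /= rmorphB.
  - by split=> [|u v]; apply: val_inj; rewrite /= ?rmorph1 ?rmorphM.
  - exists (f _ sVK) => u; apply: val_inj; rewrite /= ?fgal_invK ?fgal_invKV //.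
  - by apply: val_inj; rewrite /= fs.
by exists (MkFgal gal_f).
Qed.

(** * Finite quotients of the absolute Galois group *)

Section FiniteQuotient.
Variables (gT : finGroupType) (phi : fgal Crat -> gT).
Hypothesis phiM : {morph phi : s t / (s * t)%g}.

Lemma gal_morph1 : phi 1%g = 1%g.
Proof. by apply: (mulgI (phi 1%g)); rewrite -phiM !mulg1. Qed.

Lemma gal_morphV s : phi (s^-1)%g = ((phi s)^-1)%g.
Proof. by apply: (mulgI (phi s)); rewrite -phiM !mulgV gal_morph1. Qed.

Definition fix_image (S : {pred algC}) : {set gT} :=
  [set g | `[< exists2 s, fixes S s & phi s = g >]].

Lemma fix_imageP (S : {pred algC}) g :
  reflect (exists2 s, fixes S s & phi s = g) (g \in fix_image S).
Proof. by rewrite inE; apply: asboolP. Qed.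

Lemma fix_image_group_set (S : {pred algC}) : group_set (fix_image S).
Proof.
apply/group_setP; split=> [|_ _ /fix_imageP[s fs <-] /fix_imageP[t ft <-]].
  by apply/fix_imageP; exists 1%g; rewrite ?gal_morph1.
by apply/fix_imageP; exists (s * t)%g; rewrite ?phiM //; apply: fixesM.
Qed.
Canonical fix_image_group S := Group (fix_image_group_set S).

End FiniteQuotient.

(** [T] carries no finite group structure, hence an injective morphism with prescribed image instead
    of [isog]. *)
Definition iso_onto (T : groupType) (gT : finGroupType) (H : {set gT}) :=
  exists f : T -> gT, [/\ {morph f : x y / (x * y)%g}, injective f
    & forall g, g \in H <-> exists x, f x = g].

(** Gal([K]/[L]) is the quotient of Gal([algC]/[L]) by Gal([algC]/[K]). Applying [phi] to both keeps
    the quotient, since the part of its kernel over [L] already fixes [K]. *)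
Lemma relGal_quotient K L (gT : finGroupType) (phi : fgal Crat -> gT)
    (phiM : {morph phi : s t / (s * t)%g}) :
  {subset L <= K} -> stable_over L K ->
  (forall s, fixes L s -> phi s = 1%g -> fixes K s) ->
  (fix_image phi K <| fix_image phi L)%g /\
  iso_onto (relGal K L) (fix_image_group phiM L / fix_image_group phiM K)%g.
Proof.
move=> LK stK kerK; set N := fix_image phi K; set I := fix_image phi L.
have fKL s : fixes K s -> fixes L s by move=> fs x /LK/fs.
have nNI : (N <| I)%g.
  apply/andP; split.
    by apply/subsetP => _ /fix_imageP[s fs <-]; apply/fix_imageP; exists s; auto.
  apply/subsetP => _ /fix_imageP[s fs <-]; rewrite inE.
  apply/subsetP => _ /imsetP[_ /fix_imageP[t ft <-] ->].
  apply/fix_imageP; exists (t ^ s)%g; last first.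
    by rewrite /conjg !phiM (gal_morphV phiM).
  move=> x Kx; rewrite /conjg /= ft ?fgal_invK //; exact: stK.
split=> //; have [lift liftP] := choice (relGal_lift LK).
have lift_L r : fixes L (lift r) by have [] := liftP r.
have liftE r u : lift r (val u) = val (r u) by have [_ ->] := liftP r.
have NI s : fixes L s -> phi s \in 'N(N)%g.
  by move=> fs; apply: (subsetP (normal_norm nNI)); apply/fix_imageP; exists s.
(* The coset depends only on the restriction to [K], so the choice of lifts is immaterial. *)
have cosE s t : fixes L s -> fixes L t -> {in K, s =1 t} ->
    coset N (phi s) = coset N (phi t).
  move=> fs ft st; have Dt : t = (s * (s^-1 * t))%g by rewrite mulKVg.
  have fst : fixes L (s^-1 * t)%g by apply: fixesM => //; apply: fixesV.
  rewrite {1}Dt phiM morphM ?NI //= [X in (_ * X)%g]coset_id ?mulg1 //.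
  apply/fix_imageP; exists (s^-1 * t)%g => // x Kx.
  by rewrite -[LHS]/((s^-1)%g (t x)) -st // fgalVK.
exists (fun r => coset N (phi (lift r))); split=> [r r'|r r' /= eq_rr'|g].
- rewrite -morphM ?NI // -phiM; apply: cosE => [||x Kx] //; first exact: fixesM.
  by rewrite -[x]/(val (Subfield Kx)) liftE /= -!liftE.
- have: phi (lift r * (lift r')^-1)%g \in N.
    rewrite phiM (gal_morphV phiM); apply: coset_idr.
      by rewrite groupM ?groupV ?NI.
    by rewrite morphM ?groupV ?NI // morphV ?NI //= eq_rr' mulgV.
  case/fix_imageP=> s fs phis; apply: fgal_eq => u; apply: val_inj.
  have fr : fixes L (lift r * (lift r')^-1)%g by apply: fixesM => //; apply: fixesV.
  have fK: fixes K (s^-1 * (lift r * (lift r')^-1))%g.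
    apply: kerK; first by apply: fixesM => //; apply/fixesV/fKL.
    by rewrite phiM (gal_morphV phiM) phis mulVg.
  have := fixesM fs fK; rewrite mulKVg => /(_ (val (r' u)) (valP _)) <-.
  by rewrite -liftE -liftE /= fgal_invK.
- split=> [/morphimP[h _ /fix_imageP[s fs <-] ->]|[r <-]].
    have [r rE] := relGal_restrict stK fs; exists r; apply: cosE => // x Kx.
    by rewrite -[x]/(val (Subfield Kx)) liftE.
  by apply: mem_quotient; apply/fix_imageP; exists (lift r).
Qed.

(** * Closed subgroups as stabilisers of their fixed fields *)

Section Artin.
Variables (gT : finGroupType) (phi : fgal Crat -> gT) (c : seq algC).
Hypothesis phiM : {morph phi : s t / (s * t)%g}.
Hypothesis ker_phi : forall s, phi s = 1%g <-> {in c, s =1 id}.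
Variable J : {group gT}.

Lemma gal_morph_eq s t : phi s = phi t <-> {in c, s =1 t}.
Proof.
have -> : phi s = phi t <-> phi (t^-1 * s)%g = 1%g.
  rewrite phiM (gal_morphV phiM); split=> [->|/eqP]; first exact: mulVg.
  by rewrite -eq_mulVg1 => /eqP.
rewrite ker_phi; split=> st x cx; last by rewrite /= st ?fgal_invK.
by apply: (bij_inj (fgal_bij t^-1%g)); rewrite fgalVK -[RHS](st x cx).
Qed.

(* The polynomial prod_(g in J) (Y - sum_i g(c_i) X^i) has coefficients in the
   fixed field of J, and a permutation of its roots by s forces s into J. *)
Lemma fixfield_closed s :
  fixes (fixfield (fun t => phi t \in J)) s -> phi s \in J.
Proof.
(* [phi] need not be onto: the product runs over the elements of [J] that come from an automorphism,
   and [sec] chooses one, with dummy value 1 elsewhere. *)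
move=> fs; pose J' := [set g in J | `[< exists t, phi t = g >]].
have J'P g : g \in J' -> exists t, phi t = g by rewrite inE => /andP[_ /asboolP].
have secP g : exists t, g \in J' -> phi t = g.
  have [/J'P[t <-]|_] := boolP (g \in J'); first by exists t.
  by exists 1%g.
have [sec secE] := choice secP.
(* One polynomial records the images of all of [c], so a single root determines [phi t]. *)
pose P (t : fgal Crat) := Poly (map t c).
pose pol := \prod_(g in J') ('X - (P (sec g))%:P).
have mapP (t u : fgal Crat) : map_poly t (P u) = P (t * u)%g.
  apply/polyP => i; rewrite coef_map !coef_Poly; have [ci|ci] := ltnP i (size c).
    by rewrite !(nth_map 0).
  by rewrite !nth_default ?size_map ?raddf0.
have P_eq t u : phi t = phi u -> P t = P u.
  by move/gal_morph_eq => tu; congr Poly; apply/eq_in_map.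
have mapl (t : fgal Crat) : map_poly (map_poly t) pol
    = \prod_(g in J') ('X - (P (t * sec g)%g)%:P).
  rewrite rmorph_prod; apply: eq_bigr => g _.
  by rewrite rmorphB /= map_polyX map_polyC /= mapP.
have polJ (t : fgal Crat) : phi t \in J -> map_poly (map_poly t) pol = pol.
  move=> Jt; rewrite mapl /pol [RHS](reindex_inj (mulgI (phi t))) /=.
  have J't g : ((phi t * g)%g \in J') = (g \in J').
    rewrite !inE groupMl //; congr (_ && _); apply/asboolP/asboolP => -[u ug].
      by exists (t^-1 * u)%g; rewrite phiM (gal_morphV phiM) ug mulKg.
    by exists (t * u)%g; rewrite phiM ug.
  rewrite [RHS](eq_bigl _ _ J't); apply: eq_bigr => g J'g; congr ('X - _%:P).
  by apply: P_eq; rewrite phiM !secE ?J't.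
have pol_s : map_poly (map_poly s) pol = pol.
  apply/polyP => i; rewrite coef_map; apply/polyP => j; rewrite coef_map /=.
  apply: fs; apply/asboolP => t /polJ{2}<-.
  by rewrite !coef_map.
have J'1 : 1%g \in J'.
  by rewrite inE group1; apply/asboolP; exists 1%g; apply: gal_morph1.
(* The factor of [g = 1] in the product transformed by [s] vanishes at [P s]. *)
have: root pol (P s).
  rewrite -pol_s mapl (bigD1 1%g) //= rootM root_XsubC (P_eq _ s) ?eqxx //.
  by rewrite phiM secE // mulg1.
rewrite /root horner_prod prodf_seq_eq0 => /hasP[g _ /andP[J'g]].
rewrite hornerXsubC subr_eq0 => /eqP Psg.
suff -> : phi s = phi (sec g) by rewrite secE //; move: J'g; rewrite inE => /andP[].
apply/gal_morph_eq => x /(nthP 0)[i ci <-].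
by have := congr1 (fun f : {poly _} => f`_i) Psg; rewrite !coef_Poly !(nth_map 0).
Qed.

End Artin.

End GaloisTheory.

(** * Isomorphism types of small groups *)

Section GroupIso.

Lemma inj_surj_bij (T U : choiceType) (f : T -> U) :
  injective f -> (forall y, exists x, f x = y) -> bijective f.
Proof.
move=> f_inj f_surj; have [g gK] := choice f_surj.
by exists g => // x; apply: f_inj; rewrite gK.
Qed.

Lemma group_iso_sym (G H : groupType) : group_iso G H -> group_iso H G.
Proof.
case=> f fM [g fK gK]; exists g; last by exists f.
by move=> x y; apply: (can_inj fK); rewrite fM !gK.
Qed.

Lemma group_iso_trans (G H K : groupType) :
  group_iso G H -> group_iso H K -> group_iso G K.
Proof.
move=> [f fM f_bij] [g gM g_bij]; exists (g \o f); last exact: bij_comp.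
by move=> x y /=; rewrite fM gM.
Qed.

Lemma iso_onto_isog (T : groupType) (gT rT : finGroupType)
    (G : {group gT}) (H : {group rT}) :
  iso_onto T G -> G \isog H -> iso_onto T H.
Proof.
move=> [f [fM f_inj fG]] /isogP[g g_inj gG].
have Gf x : f x \in G by apply/fG; exists x.
exists (g \o f); split=> [x y|x y /= eq_xy|h] /=; first by rewrite fM morphM.
  by apply/f_inj/(injmP g_inj).
rewrite -gG; split=> [/morphimP[k _ /fG[x <-] ->]|[x <-]]; first by exists x.
exact: mem_morphim.
Qed.

Lemma iso_onto_setT (T : groupType) (gT : finGroupType) :
  iso_onto T [set: gT] -> group_iso T gT.
Proof.
move=> [f [fM f_inj fT]]; exists f => //; apply: inj_surj_bij => // y.
by apply/fT; rewrite inE.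
Qed.

Lemma iso_onto_cyclic (T : groupType) (gT : finGroupType) (G : {group gT}) n :
  iso_onto T G -> cyclic G -> #|G| = n.+1 -> group_iso T 'I_n.+1.
Proof.
move=> isoG cycG cardG; apply: iso_onto_setT.
apply: (@iso_onto_isog _ _ _ G [set: 'I_n.+1]%G) => //.
rewrite isog_cyclic_card //= Zp_cycle cycle_cyclic -Zp_cycle.
by rewrite cardsT card_ord cardG eqxx.
Qed.

Lemma iso_onto_trivial (T : groupType) (gT : finGroupType) (G : {group gT}) :
  iso_onto T G -> #|G| = 1%N -> group_iso T 'I_1.
Proof.
move=> isoG G1; apply: (iso_onto_cyclic isoG _ G1).
by rewrite (card1_trivg G1) cyclic1.
Qed.

(** ['I_p.-1.+1] is visibly a nonempty ordinal, so it has a group structure; for [p] equal to 2 or 3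
    it computes to ['Z_p]. *)
Lemma iso_onto_prime (T : groupType) (gT : finGroupType) (G : {group gT}) p :
  iso_onto T G -> prime p -> #|G| = p -> group_iso T 'I_p.-1.+1.
Proof.
move=> isoG pr_p Gp; apply: (iso_onto_cyclic isoG).
  by rewrite prime_cyclic ?Gp.
by rewrite Gp prednK ?prime_gt0.
Qed.

Lemma group_iso_card (gT rT : finGroupType) : group_iso gT rT -> #|gT| = #|rT|.
Proof. by case=> f _ /bij_eq_card. Qed.

Definition small_type (G : groupType) :=
  [\/ group_iso G 'I_1, group_iso G 'Z_2, group_iso G 'Z_3 | group_iso G 'S_3].

(** The order of the section divides 6. Orders 1, 2 and 3 determine the group; order 6 forces
    [n = 3], [N] trivial and [I] everything. *)
Lemma small_type_section (T : groupType) n (I N : {group 'S_n}) :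
  (n <= 3)%N -> (N <| I)%g -> iso_onto T (I / N)%g -> small_type T.
Proof.
move=> n_le3 nNI isoT.
have cardI : (#|N| * #|(I / N)%g|)%N = #|I|.
  by rewrite card_quotient ?normal_norm // Lagrange ?normal_sub.
have dvd_n : (#|I| %| n`!)%N by rewrite -card_Sn -cardsT cardSg ?subsetT.
have dvd_6 : (n`! %| 6)%N by case: n n_le3 {I N nNI isoT cardI dvd_n} => [|[|[|[]]]].
have dvdIN : (#|(I / N)%g| %| 6)%N.
  by apply: dvdn_trans dvd_6; apply: dvdn_trans dvd_n; rewrite -cardI dvdn_mull.
have: #|(I / N)%g| \in divisors 6 by rewrite -dvdn_divisors.
rewrite (_ : divisors 6 = [:: 1; 2; 3; 6]%N) // !inE.
case/or4P=> /eqP cardIN.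
- exact/Or41/(iso_onto_trivial isoT).
- by apply: Or42; apply: (@iso_onto_prime _ _ _ 2 isoT).
- by apply: Or43; apply: (@iso_onto_prime _ _ _ 3 isoT).
apply: Or44; move: (dvd_n); rewrite -cardI cardIN => dvd6n.
have n3 : n = 3%N.
  have: (6 %| n`!)%N by apply: dvdn_trans dvd6n; rewrite dvdn_mull.
  by case: n n_le3 {I N nNI isoT cardI dvd_n dvd_6 dvdIN cardIN dvd6n} => [|[|[|[]]]].
subst n; have N1 : N :=: 1%g.
  by apply: card1_trivg; apply/eqP; rewrite -dvdn1 -(@dvdn_pmul2r 6) ?mul1n //.
have IT : I :=: setT.
  by apply/eqP; rewrite eqEcard subsetT cardsT card_Sn -cardI cardIN N1 cards1.
apply: iso_onto_setT; apply: (@iso_onto_isog _ _ _ (I / N) [set: 'S_3])%G => //.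
rewrite isog_sym -[X in X \isog _]IT; apply: quotient_isog (normal_norm nNI) _.
by rewrite N1; apply/setIidPl; apply: sub1G.
Qed.

(** This recognises GL_2(Z/2) as S_3 by its order, with no explicit isomorphism. *)
Lemma small_type_card6 (T : groupType) (gT : finGroupType) :
  group_iso T gT -> #|gT| = 6%N -> small_type T -> group_iso T 'S_3.
Proof.
move=> T_gT gT6; have gT_T := group_iso_sym T_gT.
by case=> // isoT; have := group_iso_card (group_iso_trans gT_T isoT);
  rewrite gT6 card_ord.
Qed.

End GroupIso.

(** * Torsion fields and entanglement *)

Section Torsion.
Variable E : elliptic_curve.
Implicit Types (L : divringClosed algC) (s : fgal Crat).

Lemma torsion_coord_act n s z : torsion_coord E n z -> torsion_coord E n (s z).
Proof.
case=> x [y [Txy Dz]]; exists (s x), (s y); split; first exact: (ec_act_torsion s Txy).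
by case: Dz => ->; [left | right].
Qed.

Lemma torsion_field_stable L n : stable_over L (torsion_field E L n).
Proof. by apply: adjoin_stable => s z; apply: torsion_coord_act. Qed.

Lemma sub_torsion_field L n : {subset L <= torsion_field E L n}.
Proof. by move=> x Lx; apply/asboolP => M LM _; apply: LM. Qed.

Lemma sub_entanglement_field L m n :
  {subset L <= capfield (torsion_field E L m) (torsion_field E L n)}.
Proof. by move=> x Lx; apply/andP; split; apply: sub_torsion_field. Qed.

Lemma entanglement_field_stable L m n :
  stable_over L (capfield (torsion_field E L m) (torsion_field E L n)).
Proof.
by move=> s fs x /andP[x1 x2]; apply/andP; split; apply: torsion_field_stable.
Qed.

Lemma entanglement_quotient L m n (gT : finGroupType) (phi : fgal Crat -> gT)
    (phiM : {morph phi : s t / (s * t)%g}) :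
  (forall s, phi s = 1%g -> forall z, torsion_coord E m z -> s z = z) ->
  let K := capfield (torsion_field E L m) (torsion_field E L n) in
  (fix_image phi K <| fix_image phi L)%g /\
  iso_onto (entanglement E m n L) (fix_image_group phiM L / fix_image_group phiM K)%g.
Proof.
move=> ker_phi K; apply: relGal_quotient.
- exact: sub_entanglement_field.
- exact: entanglement_field_stable.
by move=> s fs /ker_phi tor_s x /andP[+ _]; apply: (fixes_adjoin _ _ _).2.
Qed.

(** The list holds the roots of the 2-division polynomial 4x^3 + b2 x^2 + 2 b4 x + b6. No basis of
    E[2] is assumed; the y-coordinate of a 2-torsion point is a rational expression in x. *)
Lemma two_torsion_roots : exists rs : seq algC,
  [/\ uniq rs, (size rs <= 3)%N, forall s z, z \in rs -> s z \in rs
    & forall s, {in rs, s =1 id} -> forall z, torsion_coord E 2 z -> s z = z].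
Proof.
pose p0 : {poly rat} := Poly [:: 4 * ec_a6 E + ec_a3 E ^+ 2;
  4 * ec_a4 E + 2 * ec_a1 E * ec_a3 E; 4 * ec_a2 E + ec_a1 E ^+ 2; 4].
have sz_p0 : size p0 = 4%N by rewrite /p0 (@PolyK _ 0).
pose p : {poly algC} := map_poly ratr p0.
have nz_p : p != 0 by rewrite map_poly_eq0 -size_poly_gt0 sz_p0.
have [r Dr] := closed_field_poly_normal p.
have rP z : (z \in undup r) = root p z.
  by rewrite mem_undup Dr rootZ ?lead_coef_eq0 // root_prod_XsubC.
exists (undup r); split; first exact: undup_uniq.
- apply: leq_trans (size_undup r) _; rewrite -ltnS.
  have <- : size p = 4%N by rewrite size_map_poly.
  by rewrite Dr size_scale ?lead_coef_eq0 // size_prod_XsubC.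
- move=> s z; rewrite !rP => pz; have -> : p = map_poly s p.
    by rewrite /p -map_poly_comp; apply: eq_map_poly => a /=; rewrite fmorph_rat.
  by rewrite fmorph_root.
move=> s fs z [x [y [Txy Dz]]].
case/andP: Txy => /= /eqP cxy; rewrite eqxx /=.
(* The double of an affine point is [Inf] only in the first branch of [ec_add]. *)
case: ifP => // /eqP y2 _.
have Dy : y = - (ratr (ec_a1 E) * x + ratr (ec_a3 E)) / 2.
  apply: (canRL (mulfK _)); first by rewrite Num.Theory.pnatr_eq0.
  apply: (addIr (ratr (ec_a1 E) * x + ratr (ec_a3 E))); rewrite addNr -y2; ring.
have sx : s x = x.
  apply: fs; rewrite rP /root horner_coef size_map_poly sz_p0.
  rewrite !big_ord_recr big_ord0 /= !coef_map !coef_Poly /=.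
  rewrite !(rmorphD, rmorphM, rmorphXn, rmorph_nat) /= expr0 expr1 mulr1 add0r.
  move: cxy y2; set a1 := ratr _; set a3 := ratr _; set a2 := ratr _.
  set a4 := ratr _; set a6 := ratr _ => cxy y2; apply/eqP.
  (* Completing the square in the curve equation. *)
  rewrite [LHS](_ : _ = (y + y + a1 * x + a3) ^+ 2 - 4 * ((y ^+ 2 + a1 * x * y + a3 * y)
    - (x ^+ 3 + a2 * x ^+ 2 + a4 * x + a6))); last by ring.
  by rewrite y2 cxy subrr mulr0 subr0 expr2 mulr0.
by case: Dz => -> //; rewrite Dy fmorph_div rmorphN rmorphD rmorphM
  !fmorph_rat rmorph_nat /= sx.
Qed.

Lemma perm_representation (rs : seq algC) :
  uniq rs -> (forall s z, z \in rs -> s z \in rs) ->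
  exists2 phi : fgal Crat -> 'S_(size rs), {morph phi : s t / (s * t)%g}
    & forall s, phi s = 1%g -> {in rs, s =1 id}.
Proof.
move=> uniq_rs rs_st.
have idxP s (i : 'I_(size rs)) : (index (s (nth 0%R rs i)) rs < size rs)%N.
  by rewrite index_mem rs_st ?mem_nth.
pose f s i := Ordinal (idxP s i).
have fE s i : nth 0 rs (f s i) = s (nth 0 rs i) by rewrite nth_index ?rs_st ?mem_nth.
have nth_inj (i j : 'I_(size rs)) : nth 0 rs i = nth 0 rs j -> i = j.
  by move/eqP; rewrite nth_uniq // => /eqP/val_inj.
have f_inj s : injective (f s).
  move=> i j eq_ij; apply: nth_inj; apply: (bij_inj (fgal_bij s)).
  by rewrite -!fE eq_ij.
(* Permutations multiply from left to right, automorphisms compose from right to left; the inverse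
   reconciles the two. *)
exists (fun s => perm (f_inj s^-1%g)) => [s t|s /permP s1 z rz].
  apply/permP => i; rewrite permM !permE; apply: nth_inj.
  by rewrite !fE invMg.
pose i := Ordinal (etrans (index_mem z rs) rz).
have := s1 i; rewrite permE perm1 => /(congr1 (fun k : 'I__ => nth 0 rs k)).
rewrite fE /= nth_index // => sz; apply: (bij_inj (fgal_bij s^-1%g)).
exact: etrans (fgalVK s z) (esym sz).
Qed.

Lemma entanglement_small L n : small_type (entanglement E 2 n L).
Proof.
have [rs [uniq_rs sz_rs rs_st rs_tor]] := two_torsion_roots.
have [phi phiM phi_ker] := perm_representation uniq_rs rs_st.
have [nNI isoT] := @entanglement_quotient L 2 n _ phi phiM
  (fun s ps => rs_tor s (phi_ker s ps)).
exact: small_type_section sz_rs nNI isoT.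
Qed.

Section Basis.
Variables (n : nat) (B : torsion_basis E n).

Definition point_coords (P : point) := if P is Aff x y then [:: x; y] else [::].
Definition basis_coords : seq algC :=
  flatten [seq point_coords (B v) | v <- enum 'cV['Z_n]_2].

Lemma basis_coordsP z : z \in basis_coords <-> torsion_coord E n z.
Proof.
split=> [/flatten_mapP[v _]|[x [y [/(tb_img B)[v Bv] Dz]]]].
  case Bv: (B v) => [|x y] //=; rewrite !inE => /orP Dz; exists x, y; split.
    by apply/(tb_img B); exists v.
  by case: Dz => /eqP; [left | right].
apply/flatten_mapP; exists v; rewrite ?mem_enum // Bv /= !inE.
by case: Dz => ->; rewrite eqxx ?orbT.
Qed.

Lemma rho_eq1 s : rho B s = 1%g <-> forall z, torsion_coord E n z -> s z = z.
Proof.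
have -> : rho B s = 1%g <-> forall v, ec_act s (B v) = B v.
  split=> [/(congr1 val)/= rs v|sB]; first by rewrite -rho_mxP rs mul1mx.
  apply: val_inj => /=; apply: mulcV_inj => v; apply: (@tb_inj _ _ B).
  by rewrite rho_mxP sB mul1mx.
split=> [sB z [x [y [/(tb_img B)[v Bv] Dz]]]|tor_s v].
  by have := sB v; rewrite Bv /= => -[sx sy]; case: Dz => ->.
case Bv: (B v) => [|x y] //=.
have Txy : ec_torsion E n (Aff x y) by apply/(tb_img B); exists v.
by rewrite !tor_s //; exists x, y; split=> //; [right | left].
Qed.

Lemma rho_ker s : rho B s = 1%g <-> {in basis_coords, s =1 id}.
Proof.
rewrite rho_eq1; split=> tor_s z; first by move/basis_coordsP/tor_s.
by move=> Tz; apply/tor_s/basis_coordsP.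
Qed.

End Basis.

(** This bounds the entanglement groups when the mod 2 image is small: their orders divide that of
    the image. *)
Lemma entanglement_rho L n (B2 : torsion_basis E 2) :
  exists I N : {group {'GL_2['Z_2]}},
  [/\ I \subset rho_img B2, (N <| I)%g & iso_onto (entanglement E 2 n L) (I / N)%g].
Proof.
have [nNI isoT] := @entanglement_quotient L 2 n _ _ (rhoM B2)
  (fun s => (rho_eq1 B2 s).1).
eexists; eexists; split; [|exact: nNI|exact: isoT].
apply/subsetP => _ /fix_imageP[s _ <-]; rewrite inE; apply/asboolP.
by exists s.
Qed.

End Torsion.

(** * Realising the subgroups of the mod 2 image *)

Section Lift.
Variable q : nat.

(* The three nonzero vectors u of (Z/2)^2 lift to (1, 0), (0, 1), (-1, -1),
   which sum to 0 and are permuted by GL_2(Z/2) as the u are; this embeds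
   GL_2(Z/2) in GL_2(Z), hence in GL_2(Z/q). *)
Definition lift_entry (x y : 'Z_2) : 'Z_q :=
  if x == 0 then 0 else if y == 0 then 1 else -1.

(** Columns are lifted one by one; [rev_ord i] reaches the other entry of the column, which decides
    the sign. *)
Definition lift_mx (A : 'M['Z_2]_2) : 'M['Z_q]_2 :=
  \matrix_(i, j) lift_entry (A i j) (A (rev_ord i) j).

(** The columns of an invertible matrix are distinct and nonzero, so their lifts and the lift of
    their sum add to 0. The proof checks all cases. *)
Lemma lift_entryM (a b c d e g : 'Z_2) : a * d - b * c != 0 ->
  lift_entry (a * e + b * g) (c * e + d * g)
    = lift_entry a c * lift_entry e g + lift_entry b d * lift_entry g e.
Proof.
have Z2 (P : 'Z_2 -> Prop) : P 0 -> P 1 -> forall x, P x.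
  by move=> P0 P1 [[|[|//]] lt_x]; [have -> : Ordinal lt_x = 0 by apply: val_inj
    | have -> : Ordinal lt_x = 1 by apply: val_inj].
by elim/Z2: a; elim/Z2: b; elim/Z2: c; elim/Z2: d => //= _;
  elim/Z2: e; elim/Z2: g; rewrite /lift_entry /=; ring.
Qed.

Lemma det2_unit_neq0 (A : 'M['Z_2]_2) :
  A \in unitmx -> A 0 0 * A 1 1 - A 0 1 * A 1 0 != 0.
Proof.
rewrite unitmxE => uA; suff <- : \det A = A 0 0 * A 1 1 - A 0 1 * A 1 0.
  by apply: contraTneq uA => ->; rewrite unitr0.
rewrite (expand_det_row _ 0) !big_ord_recr big_ord0 /= /cofactor !det_mx11 !mxE /=.
have w0 : widen_ord (leqnSn 1) ord_max = 0 :> 'I_2 by apply: val_inj.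
have m1 : ord_max = 1 :> 'I_2 by apply: val_inj.
have l0 : lift 0 0 = 1 :> 'I_2 by apply: val_inj.
have l1 : lift 1 0 = 0 :> 'I_2 by apply: val_inj.
rewrite w0 m1 l0 l1; ring.
Qed.

Lemma lift_mxM (A B : 'M['Z_2]_2) :
  A \in unitmx -> lift_mx (A *m B) = lift_mx A *m lift_mx B.
Proof.
move/det2_unit_neq0 => dA.
(* The second row of the product is the first-row formula for [A] with its rows exchanged. *)
have dA' : A 1 0 * A 0 1 - A 1 1 * A 0 0 != 0.
  by rewrite -oppr_eq0 opprB mulrC [X in _ - X]mulrC.
have rev0 : rev_ord (0 : 'I_2) = 1 by apply: val_inj.
have rev1 : rev_ord (1 : 'I_2) = 0 by apply: val_inj.
have E (R : comNzRingType) (f : 'I_2 -> R) : \sum_i f i = f 0 + f 1.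
  by rewrite !big_ord_recr big_ord0 /= add0r; congr (f _ + f _); apply: val_inj.
apply/matrixP => i j; rewrite !mxE !E !mxE.
have [->|->] : i = 0 \/ i = 1.
  by case: i => [[|[|//]] lt_i]; [left|right]; apply: val_inj.
  by rewrite !rev0 !rev1; apply: lift_entryM.
by rewrite !rev0 !rev1; apply: lift_entryM.
Qed.

(** As 1 and -1 are nonzero, lifting preserves the pattern of zeros, which determines a matrix over
    Z/2. *)
Lemma lift_mx_eq1 (A : 'M['Z_2]_2) : lift_mx A = 1%:M <-> A = 1%:M.
Proof.
split=> [A1|->]; apply/matrixP => i j.
  have := congr1 (fun M : 'M_2 => M i j) A1; rewrite !mxE /lift_entry.
  have [-> /esym/eqP|nz] := eqVneq (A i j) 0.
    by case: (i == j); rewrite //= oner_eq0.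
  case: (i == j) => [_|]; last first.
    by case: ifP => _ /eqP; rewrite ?oppr_eq0 oner_eq0.
  by case: (A i j) nz => [[|[|//]] lt] nz; apply: val_inj.
rewrite !mxE /lift_entry; have [->|//] := eqVneq i j.
by case: j => [[|[|//]]].
Qed.

Lemma lift_unit (g : {'GL_2['Z_2]}) : lift_mx (val g) \is a GRing.unit.
Proof.
have gV : lift_mx (val g) *m lift_mx (val g^-1%g) = 1%:M.
  rewrite -lift_mxM; last exact: (valP g).
  by apply/lift_mx_eq1; rewrite -[LHS]/(val (g * g^-1)%g) mulgV.
exact: (mulmx1_unit gV).1.
Qed.

Definition lift_GL (g : {'GL_2['Z_2]}) : {'GL_2['Z_q]} := FinRing.Unit (lift_unit g).

Lemma lift_GLM : {morph lift_GL : g h / (g * h)%g}.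
Proof. by move=> g h; apply: val_inj; apply: lift_mxM; apply: (valP g). Qed.

Lemma lift_GL_eq1 g : lift_GL g = 1%g -> g = 1%g.
Proof. by move/(congr1 val)/lift_mx_eq1 => g1; apply: val_inj. Qed.

End Lift.

(** * Goursat's lemma and fields with prescribed entanglement *)

Section Realisation.
Variables (E : elliptic_curve) (m n : nat) (gT rT : finGroupType).
Variables (f : fgal Crat -> gT) (g : fgal Crat -> rT) (c d : seq algC).
Hypotheses (fM : {morph f : s t / (s * t)%g}) (gM : {morph g : s t / (s * t)%g}).
Hypotheses (c_tor : forall z, z \in c <-> torsion_coord E m z)
           (d_tor : forall z, z \in d <-> torsion_coord E n z).
Hypotheses (f_ker : forall s, f s = 1%g <-> {in c, s =1 id})
           (g_ker : forall s, g s = 1%g <-> {in d, s =1 id}).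
Hypothesis triv_ent : forall s : entanglement E m n Crat, s = 1%g.
Hypothesis g_surj : forall y, exists s, g s = y.

Lemma fixes_torsion_l L s : fixes (torsion_field E L m) s <-> fixes L s /\ f s = 1%g.
Proof.
by rewrite fixes_adjoin f_ker; split=> -[fL tor]; split=> // z /c_tor; apply: tor.
Qed.

Lemma fixes_torsion_r L s : fixes (torsion_field E L n) s <-> fixes L s /\ g s = 1%g.
Proof.
by rewrite fixes_adjoin g_ker; split=> -[fL tor]; split=> // z /d_tor; apply: tor.
Qed.

(** Let [J] be the image under [f] of the kernel of [g]. The fixed field of the preimage of [J] lies
    in both torsion fields, so trivial entanglement makes every [s] fix it, and [fixfield_closed]
    puts [f s] in [J]. *)
Lemma f_onto_ker_g s : exists2 t, g t = 1%g & f t = f s.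
Proof.
pose J := fix_image_group fM (torsion_field E Crat n).
have fixQ t : fixes Crat t by move=> x; apply: fgal_fix.
suff /fix_imageP[t /fixes_torsion_r[_ tn] ts] : f s \in J by exists t.
apply: (fixfield_closed fM f_ker) => x /asboolP fix_x.
have xm : x \in torsion_field E Crat m.
  by apply: fixes_mem => t /fixes_torsion_l[_ t1]; apply: fix_x; rewrite t1 group1.
have xn : x \in torsion_field E Crat n.
  by apply: fixes_mem => t ft; apply: fix_x; apply/fix_imageP; exists t.
have xK : x \in capfield (torsion_field E Crat m) (torsion_field E Crat n).
  exact/andP.
have [r rE] := relGal_restrict (@entanglement_field_stable E Crat m n) (fixQ s).
by have := rE (Subfield xK); rewrite (triv_ent r).
Qed.

(** Lift [y] to some [u], then correct its [f]-value by an element of the kernel of [g]. *)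
Lemma joint_surj s y : exists2 t, f t = f s & g t = y.
Proof.
have [u uy] := g_surj y; have [t tn tm] := f_onto_ker_g (s * u^-1)%g.
by exists (t * u)%g; rewrite ?gM ?tn ?mul1g // fM tm -fM mulgKV.
Qed.

Variable lift : gT -> rT.
Hypothesis liftM : {morph lift : x y / (x * y)%g}.
Hypothesis lift_eq1 : forall x, lift x = 1%g -> x = 1%g.

Definition lift_graph (A : {group gT}) : {set gT * rT} :=
  [set x | (x.1 \in A) && (x.2 == lift x.1)].

Lemma lift_graph_group_set A : group_set (lift_graph A).
Proof.
have lift1 : lift 1 = 1%g by apply: (mulgI (lift 1)); rewrite -liftM !mulg1.
apply/group_setP; split=> [|[x1 y1] [x2 y2]]; rewrite !inE /=.
  by rewrite group1 lift1 /=.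
by case/andP=> Ax1 /eqP-> /andP[Ax2 /eqP->]; rewrite groupM // liftM /=.
Qed.
Canonical lift_graph_group A := Group (lift_graph_group_set A).

(* Over the fixed field of the preimage of the graph of [lift], the two torsion
   fields coincide. *)
Lemma entanglement_realise (A : {group gT}) :
  (forall x, x \in A -> exists s, f s = x) ->
  exists L, iso_onto (entanglement E m n L) A.
Proof.
move=> f_surj; pose Phi s := (f s, g s).
have PhiM : {morph Phi : s t / (s * t)%g} by move=> s t; rewrite /Phi fM gM.
have kerPhi s : Phi s = 1%g <-> {in c ++ d, s =1 id}.
  split=> [[/f_ker sc /g_ker sd] z|scd]; first by rewrite mem_cat => /orP[/sc|/sd].
  have fs : f s = 1%g by apply/f_ker => z cz; apply: scd; rewrite mem_cat cz.
  have gs : g s = 1%g by apply/g_ker => z dz; apply: scd; rewrite mem_cat dz orbT.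
  by rewrite /Phi fs gs.
pose L : divringClosed algC := fixfield (fun s => Phi s \in lift_graph_group A).
have fixL s : fixes L s <-> Phi s \in lift_graph_group A.
  by split=> [|Js x /asboolP]; [apply: fixfield_closed kerPhi _ _ | apply].
have fixLP s : fixes L s <-> f s \in A /\ g s = lift (f s).
  by rewrite fixL inE /=; split=> [/andP[? /eqP]|[-> ->]]; rewrite ?eqxx.
have [|nNI isoT] := @entanglement_quotient E L m n _ _ fM.
  by move=> s /f_ker sc z /c_tor/sc.
exists L; apply: iso_onto_isog isoT _.
have IA : fix_image f L = A.
  apply/setP => x; apply/fix_imageP/idP => [[s /fixLP[As _] <-] //|Ax].
  have [s sx] := f_surj x Ax; have [t ft gt] := joint_surj s (lift x).
  by exists t; rewrite ?ft //; apply/fixLP; rewrite ft sx.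
rewrite isog_sym -[X in X \isog _]IA.
apply: quotient_isog (normal_norm nNI) _.
(* It remains to see that an [s] fixing the intersection has [f s] trivial, that is, that the
   intersection is the whole field [torsion_field E L m]. *)
apply/trivgP; apply: subset_trans (subsetIl _ _) _.
apply/subsetP => _ /fix_imageP[s fK <-]; apply/set1P.
have fL : fixes L s by move=> x /(@sub_entanglement_field E L m n)/fK.
suff: fixes (torsion_field E L m) s by case/fixes_torsion_l.
(* On the graph, [g t = 1] forces [f t = 1] because [lift] is injective; so the [n]-torsion field
   contains the [m]-torsion field. *)
move=> x xm; apply: fK; apply/andP; split=> //.
apply: fixes_mem => t /fixes_torsion_r[tL tn].
have tm : f t = 1%g by apply: lift_eq1; have [_ <-] := (fixLP t).1 tL.
by apply: (fixes_torsion_l L t).2 xm.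
Qed.

End Realisation.

(* Note that 'I_1 is the trivial group, whereas 'Z_1 would be Z/2. *)
Theorem theorem5p1 (q : nat) (q_prime : prime q) (q_odd : odd q)
    (E : elliptic_curve) :
  (forall G : groupType, Ent E 2 q G ->
     [\/ group_iso G 'I_1, group_iso G 'Z_2, group_iso G 'Z_3
       | group_iso G 'S_3])
  /\
  (forall (B2 : torsion_basis E 2) (Bq : torsion_basis E q),
     (forall s : entanglement E 2 q Crat, s = 1%g) ->
     (forall g : {'GL_2['Z_q]}, exists s : fgal Crat, rho Bq s = g) ->
     [/\ (forall g : {'GL_2['Z_2]}, exists s : fgal Crat, rho B2 s = g) ->
           forall G : groupType, Ent E 2 q G <->
             [\/ group_iso G 'I_1, group_iso G 'Z_2, group_iso G 'Z_3
               | group_iso G 'S_3],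
         rho_img B2 \isog [set: 'Z_3] ->
           forall G : groupType, Ent E 2 q G <->
             group_iso G 'I_1 \/ group_iso G 'Z_3,
         rho_img B2 \isog [set: 'Z_2] ->
           forall G : groupType, Ent E 2 q G <->
             group_iso G 'I_1 \/ group_iso G 'Z_2
       & (forall s : fgal Crat, rho B2 s = 1%g) ->
           forall G : groupType, Ent E 2 q G <-> group_iso G 'I_1]).
Proof.
have EntP (G H : groupType) : group_iso G H -> Ent E 2 q H -> Ent E 2 q G.
  by move=> GH [L HL]; exists L; apply: group_iso_trans HL.
have Ent_small G : Ent E 2 q G -> small_type G.
  move=> [L GL]; have [] := entanglement_small E L q => TH;
    [apply: Or41 | apply: Or42 | apply: Or43 | apply: Or44];
    exact: group_iso_trans GL TH.
split=> // B2 Bq triv_ent rhoq_surj; pose I := rho_img_group B2.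
have real (A : {group {'GL_2['Z_2]}}) :
    A \subset I -> exists L, iso_onto (entanglement E 2 q L) A.
  move/subsetP => sAI; apply: (entanglement_realise (rhoM B2) (rhoM Bq)
    (basis_coordsP B2) (basis_coordsP Bq) (rho_ker B2) (rho_ker Bq) triv_ent
    rhoq_surj (@lift_GLM q) (@lift_GL_eq1 q)).
  by move=> x /sAI; rewrite inE => /asboolP.
have Ent1 G : group_iso G 'I_1 -> Ent E 2 q G.
  move=> G1; have [L isoL] := real 1%G (sub1G I).
  exists L; apply: group_iso_trans G1 (group_iso_sym _).
  by apply: iso_onto_trivial isoL _; rewrite cards1.
have Ent_prime p G : prime p -> (p %| #|I|)%N -> group_iso G 'I_p.-1.+1 -> Ent E 2 q G.
  move=> pr_p pI Gp; have [x Ix ox] := Cauchy pr_p pI.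
  have [L isoL] : exists L, iso_onto (entanglement E 2 q L) <[x]>%g.
    by apply: (real <[x]>%G); rewrite cycle_subG.
  exists L; apply: group_iso_trans Gp (group_iso_sym _).
  exact: (@iso_onto_prime _ _ <[x]>%G).
(* [n.+1] is the order of [G]; only order 1 or a prime order determines the isomorphism type. *)
have Ent_dvd G : Ent E 2 q G -> exists2 n, (n.+1 %| #|I|)%N
    & (n.+1 == 1%N) || prime n.+1 -> group_iso G 'I_n.+1.
  move=> [L GL]; have [J [N [sJI nNJ isoT]]] := entanglement_rho L q B2.
  exists #|(J / N)%g|.-1; rewrite prednK ?cardG_gt0 //.
    rewrite card_quotient ?normal_norm //; apply: dvdn_trans (dvdn_indexg _ _) _.
    exact: cardSg.
  move=> JN; apply: (group_iso_trans GL); case/orP: JN => [/eqP JN1|pr_JN].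
    by rewrite JN1; apply: iso_onto_trivial isoT JN1.
  exact: iso_onto_prime isoT pr_JN _.
have Ent_card_prime p G : prime p -> #|I| = p ->
    Ent E 2 q G <-> group_iso G 'I_1 \/ group_iso G 'I_p.-1.+1.
  move=> pr_p cardI; split=> [/Ent_dvd[n]|[/Ent1 //|]]; last first.
    by apply: Ent_prime; rewrite ?cardI.
  rewrite cardI => /(primeP pr_p).2/orP[/eqP n1|/eqP np] isoG.
    by left; case: n1 isoG => ->; apply.
  by right; rewrite -np; apply: isoG; rewrite np pr_p orbT.
split.
- move=> rho2_surj G; split=> [/Ent_small //|].
  have IT : I :=: setT.
    by apply/setP => g; rewrite !inE; apply/asboolP.
  have I6 : #|I| = 6%N.
    (* ['F_2] and ['Z_2] are convertible, so the count over the prime field applies. *)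
    by rewrite IT; have := @card_GL_2 'F_2; rewrite card_Fp.
  case; [exact: Ent1 | | |].
  + by apply: (@Ent_prime 2); rewrite // I6.
  + by apply: (@Ent_prime 3); rewrite // I6.
  move=> GS; have [L isoL] := real I (subxx _).
  apply: EntP GS _; exists L; move: isoL; rewrite /= IT => /iso_onto_setT isoL.
  have GL6 : #|{: {'GL_2['Z_2]}}| = 6%N by rewrite -cardsT -IT.
  exact: group_iso_sym (small_type_card6 isoL GL6 (entanglement_small E L q)).
- move=> /card_isog I3 G; apply: (Ent_card_prime 3) => //.
  by rewrite [LHS]I3 cardsT card_ord.
- move=> /card_isog I2 G; apply: (Ent_card_prime 2) => //.
  by rewrite [LHS]I2 cardsT card_ord.
move=> rho2_triv G; split=> [/Ent_dvd[n]|/Ent1 //].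
have -> : #|I| = 1%N.
  apply/eqP; rewrite -trivg_card1; apply/eqP/trivgP/subsetP => g.
  by rewrite !inE => /asboolP[s <-]; rewrite rho2_triv.
by rewrite dvdn1 => /eqP[->]; apply.
Qed.
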